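(* Let $P\in\mathcal{P}^{n\times m}$ be a causal plant, with a fractional representation $P=ND^{-1}$ ($N\in\mathcal{A}^{n\times m}$, $D\in\mathcal{A}^{m\times m}$ nonsingular), associated full-size minors $t_I$ ($I\in\mathcal{I}$) and full-size minor ideal $\mathfrak{t}=\sum_{I\in\mathcal{I}}(t_I)$. Then $P$ is stabilizable if and only if $$\sum_{I\in\mathcal{I}}\bigl((t_I):\mathfrak{t}\bigr)=\mathcal{A}.$$
   Context: $\mathcal{A}$ is a commutative ring with $1\neq 0$ (the set of stable causal transfer functions), and $\mathcal{F}=\{a/b : a,b\in\mathcal{A},\ b \text{ a nonzerodivisor}\}$ is its total ring of fractions. $\mathcal{Z}$ is a fixed prime ideal of $\mathcal{A}$, $\mathcal{Z}\neq\mathcal{A}$, containing all zerodivisors of $\mathcal{A}$. $\mathcal{P}=\{a/b\in\mathcal{F} : a\in\mathcal{A},\ b\in\mathcal{A}\setminus\mathcal{Z}\}$ is the set of causal transfer functions; a matrix is causal if all its entries lie in $\mathcal{P}$. $m,n$ are positive integers, and a plant is a matrix $P\in\mathcal{F}^{n\times m}$. Stabilizability: for $C\in\mathcal{F}^{m\times n}$ such that $\det(E_n+PC)$ is a nonzerodivisor of $\mathcal{F}$ (i.e. a unit of $\mathcal F$), put $$H(P,C)=\begin{bmatrix}(E_n+PC)^{-1} & -P(E_m+CP)^{-1}\\ C(E_n+PC)^{-1} & (E_m+CP)^{-1}\end{bmatrix}\in\mathcal{F}^{(m+n)\times(m+n)},$$ where $E_k$ is the $k\times k$ identity matrix. $P$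 is stabilizable if there is such a $C$ with all entries of $H(P,C)$ in $\mathcal{A}$. Full-size minors: a square matrix over $\mathcal{A}$ is nonsingular if its determinant is a nonzerodivisor. Every $P\in\mathcal{F}^{n\times m}$ can be written $P=ND^{-1}$ with $N\in\mathcal{A}^{n\times m}$, $D\in\mathcal{A}^{m\times m}$ nonsingular. Let $T=\begin{bmatrix}N\\ D\end{bmatrix}\in\mathcal{A}^{(m+n)\times m}$. $\mathcal{I}$ is the family of all $m$-element subsets of $\{1,\dots,m+n\}$; for $I=\{i_1<\dots<i_m\}\in\mathcal{I}$, $\Delta_I$ is the $m\times(m+n)$ matrix whose $(k,i_k)$-entries are $1$ and whose other entries are $0$, and $t_I=\det(\Delta_I T)$. The full-size minor ideal is $\mathfrak{t}=\sum_{I\in\mathcal{I}}(t_I)$. For ideals $\mathfrak{a},\mathfrak{b}$ of $\mathcal{A}$, $(\mathfrak{a}:\mathfrak{b})=\{f\in\mathcal{A} : f\mathfrak{b}\subset\mathfrak{a}\}$ is the quotient ideal. *)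

(* Defs.v *)
From HB Require Import structures.
From mathcomp Require Import all_boot all_order all_algebra.
From mathcomp Require Import classical_sets.

Set Implicit Arguments.
Unset Strict Implicit.
Unset Printing Implicit Defensive.

Import GRing.Theory.
Local Open Scope ring_scope.
Local Open Scope classical_set_scope.

(* In a commutative ring [GRing.lreg a] says that [a] is a nonzerodivisor
   ([0] is a zerodivisor when [1 != 0]). *)

Section TotalFractions.
Variables (A : comNzRingType) (F : comUnitRingType) (iota : {rmorphism A -> F}).

(* The three conditions determine (F, iota) up to a unique isomorphism over A;
   [iota] plays the role of the inclusion of A in F.  The division
   [iota a / iota b] is the genuine one, [iota b] being a unit by the second
   condition. *)
Definition is_total_fraction_ring : Prop :=
  [/\ injective iota,
      forall b : A, GRing.lreg b -> iota b \is a GRing.unit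
    & forall x : F, exists a b : A, GRing.lreg b /\ x = iota a / iota b].

Definition integral_mx p q (M : 'M[F]_(p, q)) : Prop :=
  forall i j, exists a : A, M i j = iota a.

Definition causal (Z : {pred A}) (x : F) : Prop :=
  exists a b : A, b \notin Z /\ x = iota a / iota b.

Definition causal_mx (Z : {pred A}) p q (M : 'M[F]_(p, q)) : Prop :=
  forall i j, causal Z (M i j).

Definition closed_loop n m (P : 'M[F]_(n, m)) (C : 'M[F]_(m, n)) :
    'M[F]_(n + m) :=
  block_mx (invmx (1%:M + P *m C))        (- (P *m invmx (1%:M + C *m P)))
           (C *m invmx (1%:M + P *m C))   (invmx (1%:M + C *m P)).

(* Every nonzerodivisor of a total ring of fractions is a unit, and
   [\det (1%:M + C *m P)] is equal to [\det (1%:M + P *m C)], so that the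
   inverses in [closed_loop] are genuine. *)
Definition stabilizable n m (P : 'M[F]_(n, m)) : Prop :=
  exists C : 'M[F]_(m, n),
    GRing.lreg (\det (1%:M + P *m C)) /\ integral_mx (closed_loop P C).

Definition fractional_representation n m
    (P : 'M[F]_(n, m)) (N : 'M[A]_(n, m)) (D : 'M[A]_m) : Prop :=
  GRing.lreg (\det D) /\ P = map_mx iota N *m invmx (map_mx iota D).

End TotalFractions.

Section Ideals.
Variable A : comNzRingType.

Definition principal_ideal (a : A) : set A := [set x | exists c, x = c * a].

Definition sum_ideal (J : finType) (K : J -> set A) : set A :=
  [set x | exists f : J -> A, (forall j, K j (f j)) /\ x = \sum_j f j].

Definition quotient_ideal (a b : set A) : set A :=
  [set f | forall x, b x -> a (f * x)].

End Ideals.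

Section FullSizeMinors.

Definition msubset (n m : nat) : finType :=
  {I : {set 'I_(n + m)} | #|I| == m}.

(* [enum_val] lists the elements of a set of ordinals in increasing order. *)
Definition msubset_nth n m (I : msubset n m) (k : 'I_m) : 'I_(n + m) :=
  enum_val (cast_ord (esym (eqP (valP I))) k).

Variable A : comNzRingType.

Definition selection_mx n m (I : msubset n m) : 'M[A]_(m, n + m) :=
  \matrix_(k, j) (j == msubset_nth I k)%:R.

Definition full_size_minor n m (N : 'M[A]_(n, m)) (D : 'M[A]_m)
    (I : msubset n m) : A :=
  \det (selection_mx I *m col_mx N D).

Definition full_size_minor_ideal n m (N : 'M[A]_(n, m)) (D : 'M[A]_m) : set A :=
  sum_ideal (fun I : msubset n m => principal_ideal (full_size_minor N D I)).

End FullSizeMinors.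

(* Main.v *)
Require Import Defs.
From HB Require Import structures.
From mathcomp Require Import all_boot all_order all_algebra all_fingroup.
From mathcomp Require Import boolp classical_sets.

(** Write [T = col_mx N D] and [G = col_mx P 1], so that [T = G D] over [F].
    Both sides of the equivalence say that the column space of [T] over [F] is
    that of an idempotent matrix with entries in [A], that is, that there is a
    matrix [Y] over [F] with [Y T = 1] and [T Y] integral ([splits iota T 1]); with
    [X = D Y] this becomes [X G = 1] and [G X] integral ([splits1_projector]).

    If [C] stabilizes [P], then [X = (1 + C P)^-1 [C, 1]] satisfies [X G = 1],
    and the blocks of [G X] are those of [H(P, C)] up to signs and to replacing
    the upper left one by its difference with [1] ([stabilizable_projector]).

    If [Y T = 1] and [T Y] is integral, let [y_J] be the minor of [Y] on the
    columns in [J].  Cauchy-Binet gives [1 = \sum_J y_J t_J], and every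
    [y_J t_I] is in [A], being a minor of [T Y].  So [l_J = y_J t_J] satisfies
    [l_J t_I = (y_J t_I) t_J], which puts it in the quotient ideal of [(t_J)]
    by the ideal of all the minors ([splits1_comaximal]).

    Conversely let [\sum_J l_J = 1] with each [l_J] in that quotient ideal.
    Where [l_J] is invertible, [t_J] generates the ideal of the minors, which
    contains the nonzerodivisor [\det D]; so the square submatrix [T_J] of [T]
    becomes invertible, and [T T_J^-1] has its entries, quotients of minors by
    [t_J], in the ring.  With denominators cleared, this shows that [l_J ^ 2]
    is in the ideal of those [x] for which some [Y] has [Y T = x 1] and [T Y]
    integral ([minor_multiple_splits]).  The [l_J ^ 2] generate the unit ideal,
    so [1] is in that ideal as well ([comaximal_splits1]).

    It remains to recover a controller from [X = [X1, X2]].  The only possible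
    one is [C = X2^-1 X1], so [X] has to be changed to make [X2] invertible, and
    here causality is used.  For a common denominator [b] of [P] outside [Z] and
    any [R] over [A], adding [[0, b R] (1 - G X)] to [X] keeps [X G = 1] and
    keeps [G X] integral, while [X2] becomes [X2 + b R (1 - X2)].  Since
    [X2 + (1 - X2) = 1] has a determinant outside the prime [Z], so has
    [X2 + b R (1 - X2)] for a suitable diagonal [R], found one row at a time by
    multilinearity ([prime_avoiding_det]); and what is outside [Z] is a
    nonzerodivisor ([causal_projector_stabilizable]). *)

Section FullSizeMinorCriterion.
Set Implicit Arguments.
Unset Strict Implicit.
Unset Printing Implicit Defensive.
Import GRing.Theory.
Local Open Scope ring_scope.

(** * Subsets of rows and minors *)
Section Enumeration.
Variables n m : nat.
Implicit Types I J : msubset n m.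

Lemma msubset_nth_inj I : injective (msubset_nth I).
Proof. by move=> k l /enum_val_inj /cast_ord_inj. Qed.

Lemma mem_msubsetP I i :
  reflect (exists k, msubset_nth I k = i) (i \in val I).
Proof.
apply: (iffP idP) => [Ii | [k <-]]; last exact: enum_valP.
exists (cast_ord (eqP (valP I)) (enum_rank_in Ii i)).
by rewrite /msubset_nth cast_ordK enum_rankK_in.
Qed.

(** A choice of distinct rows is an increasing choice followed by a permutation:
    this is what relates arbitrary maximal minors to the full-size ones. *)
Lemma injective_msubset_nth (f : 'I_m -> 'I_(n + m)) : injective f ->
  exists I (s : 'S_m), forall k, f k = msubset_nth I (s k).
Proof.
move=> f_inj; have cardS : #|[set f k | k in 'I_m]| == m.
  by rewrite card_imset // card_ord.
pose I : msubset n m := Sub [set f k | k in 'I_m] cardS.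
have fI k : exists l, msubset_nth I l == f k.
  have /mem_msubsetP[l <-] : f k \in val I by rewrite SubK imset_f.
  by exists l.
pose g k := xchoose (fI k).
have gE k : msubset_nth I (g k) = f k := eqP (xchooseP (fI k)).
have g_inj : injective g.
  by move=> k l /(congr1 (msubset_nth I)); rewrite !gE => /f_inj.
by exists I, (perm g_inj) => k; rewrite permE gE.
Qed.

Definition msubset_arrangement (u : msubset n m * 'S_m) :
    {ffun 'I_m -> 'I_(n + m)} :=
  [ffun k => msubset_nth u.1 (u.2 k)].

Lemma msubset_arrangement_inj : injective msubset_arrangement.
Proof.
move=> [I s] [J t] /ffunP eqIJ.
have {}eqIJ k : msubset_nth I (s k) = msubset_nth J (t k).
  by have := eqIJ k; rewrite !ffunE.
have IJ : I = J.
  apply/val_inj/setP => i; apply/mem_msubsetP/mem_msubsetP => -[k <-].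
    by exists (t (s^-1%g k)); rewrite -eqIJ permKV.
  by exists (s (t^-1%g k)); rewrite eqIJ permKV.
rewrite -{J}IJ in eqIJ *; congr (_, _); apply/permP => k.
exact: msubset_nth_inj (eqIJ k).
Qed.

(** Together with injectivity, this makes sums over injections into sums over
    pairs of a subset and a permutation. *)
Lemma injectiveb_arrangement (f : {ffun 'I_m -> 'I_(n + m)}) :
  injectiveb f = (f \in [set msubset_arrangement u | u in predT]).
Proof.
apply/injectiveP/imsetP => [/injective_msubset_nth[I [s fE]] | [[I s] _ ->]].
  by exists (I, s) => //; apply/ffunP => k; rewrite ffunE fE.
by move=> k l; rewrite !ffunE => /msubset_nth_inj /perm_inj.
Qed.

End Enumeration.

Section RowMinors.
Variable R : comNzRingType.

Lemma det_rowsub_perm m p (f : 'I_m -> 'I_p) (g : 'I_m -> 'I_p) (s : 'S_m)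
    (T : 'M[R]_(p, m)) :
  (forall k, f k = g (s k)) ->
  \det (rowsub f T) = (-1) ^+ s * \det (rowsub g T).
Proof.
move=> fE; rewrite -det_perm -det_mulmx -row_permE; congr (\det _).
by apply/matrixP => i j; rewrite !mxE fE.
Qed.

(** Either a row is repeated and the determinant vanishes, or the selection of
    rows is a rearrangement of an increasing one and [c] is a sign. *)
Lemma det_rowsub_minor n m (f : 'I_m -> 'I_(n + m)) (T : 'M[R]_(n + m, m)) :
  exists I c, \det (rowsub f T) = c * \det (rowsub (msubset_nth I) T).
Proof.
have [f_inj | f_ninj] := boolP (injectiveb (finfun f)).
  have {f_inj}/injective_msubset_nth[I [s fE]] : injective f.
    by move=> k l fkl; apply: (injectiveP _ f_inj); rewrite !ffunE.
  by exists I, ((-1) ^+ s); apply: det_rowsub_perm fE.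
have card_top : #|[set rshift n k | k in 'I_m]| == m.
  by rewrite card_imset ?card_ord //; apply: rshift_inj.
(* The multiplier is 0 here, so that any subset will do. *)
exists (Sub [set rshift n k | k in 'I_m] card_top), 0; rewrite mul0r.
have /injectivePn[i [j ij]] := f_ninj; rewrite !ffunE => fij.
by apply: (determinant_alternate ij) => k; rewrite !mxE fij.
Qed.

(** Each row of [Y *m T] is a combination of rows of [T]; expand the determinant
    by multilinearity in the rows. *)
Lemma det_mulmx_rowsub m p (Y : 'M[R]_(m, p)) (T : 'M[R]_(p, m)) :
  \det (Y *m T) =
  \sum_(f : {ffun 'I_m -> 'I_p}) (\prod_k Y k (f k)) * \det (rowsub f T).
Proof.
under [RHS]eq_bigr => f _ do rewrite /determinant mulr_sumr.
rewrite exchange_big; apply: eq_bigr => s _ /=.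
transitivity ((-1) ^+ s * \prod_k \sum_i Y k i * T i (s k)).
  by congr (_ * _); apply: eq_bigr => k _; rewrite mxE.
rewrite bigA_distr_bigA /= mulr_sumr; apply: eq_bigr => f _.
rewrite mulrCA -big_split; congr (_ * _).
by apply: eq_bigr => k _; rewrite !mxE.
Qed.

(** In the expansion of [det_mulmx_rowsub] only the injective choices of rows
    contribute.  Those with image [I] are indexed by permutations, whose signs
    turn the products of entries of [Y] into a determinant. *)
Lemma Cauchy_Binet n m (Y : 'M[R]_(m, n + m)) (T : 'M[R]_(n + m, m)) :
  \det (Y *m T) = \sum_(I : msubset n m)
    \det (colsub (msubset_nth I) Y) * \det (rowsub (msubset_nth I) T).
Proof.
rewrite det_mulmx_rowsub (bigID (fun f : {ffun _ -> _} => injectiveb f)) /=.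
rewrite addrC big1 ?add0r.
  under eq_bigl => f do rewrite injectiveb_arrangement.
  rewrite big_imset /=; last by move=> ? ? _ _; apply: msubset_arrangement_inj.
  under eq_bigl => u do rewrite inE.
  rewrite -(pair_big predT predT (fun I s => \prod_k
    Y k (msubset_arrangement (I, s) k) *
    \det (rowsub (msubset_arrangement (I, s)) T))) /=.
  apply: eq_bigr => I _; rewrite mulr_suml; apply: eq_bigr => s _.
  rewrite (@det_rowsub_perm _ _ _ (msubset_nth I) s).
    rewrite mulrCA mulrA; congr (_ * _ * _).
    by apply: eq_bigr => k _; rewrite ffunE mxE.
  by move=> k; rewrite ffunE.
move=> f /injectivePn[i [j ij fij]].
by rewrite (determinant_alternate ij) ?mulr0 // => k; rewrite !mxE fij.
Qed.

(** Cramer's rule: multiplying row [i] of [T] by the adjugate of a square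
    submatrix expands, along row [k], the determinant of this submatrix with its
    row [k] replaced by row [i] of [T].  Hence [T *m \adj (rowsub f T)] consists
    of minors of [T]. *)
Lemma mulmx_adj_rowsub m p (f : 'I_m -> 'I_p) (T : 'M[R]_(p, m)) i k :
  (T *m \adj (rowsub f T)) i k =
  \det (rowsub (fun l => if l == k then i else f l) T).
Proof.
rewrite (expand_det_row _ k) mxE; apply: eq_bigr => j _.
rewrite !mxE eqxx; congr (_ * (_ * \det _)).
apply/matrixP => a b; rewrite !mxE.
by rewrite [_ == k]eq_sym (negbTE (neq_lift _ _)).
Qed.

Lemma full_size_minorE n m (N : 'M[R]_(n, m)) (D : 'M[R]_m) (I : msubset n m) :
  full_size_minor N D I = \det (rowsub (msubset_nth I) (col_mx N D)).
Proof.
rewrite /full_size_minor rowsubE; congr (\det (_ *m _)).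
by apply/matrixP => i j; rewrite !mxE eq_sym.
Qed.

End RowMinors.

(** * Integral matrices *)

Section Splitting.
Variables (A : comNzRingType) (F : comUnitRingType) (iota : {rmorphism A -> F}).

Lemma integral_mxP p q (M : 'M[F]_(p, q)) :
  integral_mx iota M <-> exists M0, M = map_mx iota M0.
Proof.
split=> [MA | [M0 ->] i j]; last by exists (M0 i j); rewrite mxE.
have [h hE] := choice (fun u : 'I_p * 'I_q => MA u.1 u.2).
exists (\matrix_(i, j) h (i, j)); apply/matrixP => i j.
by rewrite !mxE -(hE (i, j)).
Qed.

Lemma integral_map_mx p q (M : 'M[A]_(p, q)) : integral_mx iota (map_mx iota M).
Proof. by apply/integral_mxP; exists M. Qed.

Lemma integral_mx1 p : integral_mx iota (1%:M : 'M[F]_p).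
Proof. by rewrite -(map_mx1 iota); apply: integral_map_mx. Qed.

Lemma integral_mxD p q (M M' : 'M[F]_(p, q)) :
  integral_mx iota M -> integral_mx iota M' -> integral_mx iota (M + M').
Proof.
by move=> /integral_mxP[? ->] /integral_mxP[? ->]; rewrite -map_mxD;
  apply: integral_map_mx.
Qed.

Lemma integral_mxN p q (M : 'M[F]_(p, q)) :
  integral_mx iota M -> integral_mx iota (- M).
Proof. by move=> /integral_mxP[? ->]; rewrite -map_mxN; apply: integral_map_mx. Qed.

Lemma integral_mxM p q r (M : 'M[F]_(p, q)) (M' : 'M[F]_(q, r)) :
  integral_mx iota M -> integral_mx iota M' -> integral_mx iota (M *m M').
Proof.
by move=> /integral_mxP[? ->] /integral_mxP[? ->]; rewrite -map_mxM;
  apply: integral_map_mx.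
Qed.

Lemma integral_mxZ p q a (M : 'M[F]_(p, q)) :
  integral_mx iota M -> integral_mx iota (iota a *: M).
Proof. by move=> /integral_mxP[? ->]; rewrite -map_mxZ; apply: integral_map_mx. Qed.

Lemma integral_block_mx p q r s (M1 : 'M[F]_(p, r)) (M2 : 'M[F]_(p, s))
    (M3 : 'M[F]_(q, r)) (M4 : 'M[F]_(q, s)) :
  integral_mx iota (block_mx M1 M2 M3 M4) <->
  [/\ integral_mx iota M1, integral_mx iota M2, integral_mx iota M3 &
      integral_mx iota M4].
Proof.
split=> [/integral_mxP[M] |].
  rewrite -[M]submxK map_block_mx => /eq_block_mx[-> -> -> ->].
  by split; apply: integral_map_mx.
case=> /integral_mxP[? ->] /integral_mxP[? ->].
move=> /integral_mxP[? ->] /integral_mxP[? ->].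
by rewrite -map_block_mx; apply: integral_map_mx.
Qed.

(** * Integral splittings of a matrix up to a scalar *)

(** For [x = 1], [T *m Y] is an idempotent with entries in [A] and with the
    column space of [T] over [F].  Allowing a scalar [x] makes the condition local: the [x] that satisfy
    it form an ideal, which is the whole ring as soon as it contains elements
    generating the unit ideal. *)
Definition splits p m (T : 'M[A]_(p, m)) (x : A) : Prop :=
  exists Y : 'M[F]_(m, p),
    Y *m map_mx iota T = (iota x)%:M /\ integral_mx iota (map_mx iota T *m Y).

Section SplittingIdeal.
Variables (p m : nat) (T : 'M[A]_(p, m)).

Lemma splits0 : splits T 0.
Proof.
exists 0; rewrite mul0mx mulmx0 rmorph0 raddf0; split=> //.
by rewrite -(map_mx0 iota); apply: integral_map_mx.
Qed.

Lemma splitsD x y : splits T x -> splits T y -> splits T (x + y).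
Proof.
move=> [X [XT TX]] [Y [YT TY]]; exists (X + Y).
rewrite mulmxDl XT YT mulmxDr rmorphD raddfD; split=> //.
exact: integral_mxD.
Qed.

Lemma splitsM a x : splits T x -> splits T (a * x).
Proof.
move=> [X [XT TX]]; exists (iota a *: X).
rewrite -scalemxAl XT -scalemxAr scale_scalar_mx rmorphM; split=> //.
exact: integral_mxZ.
Qed.

(** An ideal containing every [l j ^ 2] has every [l j], hence also their sum
    [1], in its radical. *)
Lemma splits_sum_sqr (J : finType) (l : J -> A) :
  (forall j, splits T (l j ^+ 2)) -> \sum_j l j = 1 -> splits T 1.
Proof.
move=> l2 suml.
have [N] : exists N, splits T ((\sum_j l j) ^+ N).
  elim/big_ind: _ => [|x y [a xa] [b yb]|j _].
  - by exists 1%N; rewrite expr1; apply: splits0.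
  - exists (a + b)%N; rewrite exprDn.
    elim/big_ind: _ => [|u v|[i /= ltiab] _]; [exact: splits0 | exact: splitsD |].
    rewrite -mulr_natl; apply: splitsM.
    (* The exponents add up to [a + b], so one of them reaches its bound. *)
    have [leib | ltbi] := leqP b i.
      by rewrite -(subnK leib) exprD; do 2!apply: splitsM.
    have le_a : (a <= a + b - i)%N by rewrite -addnBA ?leq_addr // ltnW.
    by rewrite mulrC -(subnK le_a) exprD; do 2!apply: splitsM.
  - by exists 2%N.
by rewrite suml expr1n.
Qed.

Hypothesis unit_lreg : forall b : A, GRing.lreg b -> iota b \is a GRing.unit.

(** After inverting [l], the minor [\det (rowsub f T)] divides all the others,
    and so divides the nonzerodivisor [\det (rowsub g T)]; hence [rowsub f T] is
    invertible, and the inverse, applied to the rows in [f], splits [T] by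
    Cramer's rule.  The possibly zerodividing [\det (rowsub f T)] cannot be
    inverted in [F] itself, and this is why [l] occurs squared: one factor is
    used to divide [\det (rowsub g T)], the other to divide the minors of
    [T]. *)
Lemma minor_multiple_splits (f g : 'I_m -> 'I_p) (l : A) :
    GRing.lreg (\det (rowsub g T)) ->
    (forall h : 'I_m -> 'I_p,
      exists c, l * \det (rowsub h T) = c * \det (rowsub f T)) ->
  splits T (l ^+ 2).
Proof.
set d := \det (rowsub g T) => /unit_lreg d_unit l_f.
have [a la] := l_f g; rewrite -/d in la.
(* Where [l] is invertible, [a / d] is the inverse of the minor on [f]. *)
pose y := iota (l * a) / iota d.
exists (y *: map_mx iota (\adj (rowsub f T) *m rowsub f 1%:M)).
split.
  rewrite -scalemxAl -map_mxM -mulmxA -rowsubE mul_adj_mx map_scalar_mx.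
  rewrite scale_scalar_mx; congr _%:M.
  by rewrite /y mulrAC -rmorphM /= -mulrA -la mulrA rmorphM mulrK.
have Tadj : integral_mx iota (y *: map_mx iota (T *m \adj (rowsub f T))).
  move=> i k; rewrite 2!mxE mulmx_adj_rowsub.
  have [c lc] := l_f (fun j => if j == k then i else f j); exists (c * l).
  rewrite /y mulrAC -rmorphM /= [l * a]mulrC -mulrA lc mulrCA -la.
  by rewrite mulrA rmorphM mulrK.
rewrite -scalemxAr -map_mxM mulmxA map_mxM scalemxAl.
by apply: integral_mxM Tadj _; apply: integral_map_mx.
Qed.

End SplittingIdeal.

(** * The quotient ideals of the full-size minors *)

Section FullSizeMinorIdeal.
Variables (n m : nat) (N : 'M[A]_(n, m)) (D : 'M[A]_m).

Lemma quotient_minor_idealP (J : msubset n m) (l : A) :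
  quotient_ideal (principal_ideal (full_size_minor N D J))
    (full_size_minor_ideal N D) l <->
  forall I, exists c, l * full_size_minor N D I = c * full_size_minor N D J.
Proof.
split=> [lJ I | /choice[c lc] x [h [/choice[a hE] ->]]].
  apply: lJ; exists (fun K => (K == I)%:R * full_size_minor N D K); split.
    by move=> K; exists (K == I)%:R.
  by rewrite (bigD1 I) //= eqxx mul1r big1 ?addr0 // => K /negbTE->; rewrite mul0r.
exists (\sum_I a I * c I); rewrite mulr_sumr mulr_suml.
by apply: eq_bigr => I _; rewrite hE mulrCA lc mulrA.
Qed.

Definition minor_quotients_comaximal : Prop :=
  exists l : msubset n m -> A,
    (forall J I, exists c,
      l J * full_size_minor N D I = c * full_size_minor N D J) /\
    \sum_J l J = 1.

Lemma minor_quotients_comaximalP :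
  sum_ideal (fun I : msubset n m =>
    quotient_ideal (principal_ideal (full_size_minor N D I))
                   (full_size_minor_ideal N D)) = setT <->
  minor_quotients_comaximal.
Proof.
split=> [full | [l [lJ suml]]].
  have : [set: A]%classic 1 by [].
  rewrite -full => -[l [lJ suml]]; exists l; split=> // J.
  exact/quotient_minor_idealP.
rewrite predeqE => x; split=> // _; exists (fun J => x * l J).
split=> [J |]; last by rewrite -mulr_sumr suml mulr1.
apply/quotient_minor_idealP => I; have [c lc] := lJ J I.
by exists (x * c); rewrite -!mulrA lc.
Qed.

Hypothesis iota_inj : injective iota.
Hypothesis unit_lreg : forall b : A, GRing.lreg b -> iota b \is a GRing.unit.

(** The multipliers are the principal minors of the idempotent [T *m Y]; they
    add up to [1] by Cauchy-Binet applied to [Y *m T = 1]. *)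
Lemma splits1_comaximal :
  splits (col_mx N D) 1 -> minor_quotients_comaximal.
Proof.
move=> [Y [YT /integral_mxP[Q TY]]].
pose a I J := \det (mxsub (@msubset_nth n m I) (msubset_nth J) Q).
have aE I J : iota (a I J) =
    \det (colsub (msubset_nth J) Y) * iota (full_size_minor N D I).
  rewrite /a -det_map_mx map_mxsub -TY mxsub_mul det_mulmx mulrC.
  by rewrite full_size_minorE -det_map_mx map_mxsub.
exists (fun J => a J J); split=> [J I |].
  exists (a I J); apply: iota_inj; rewrite !rmorphM !aE /=.
  by rewrite mulrAC.
apply: iota_inj; rewrite rmorph_sum rmorph1.
transitivity (\det (Y *m map_mx iota (col_mx N D))).
  rewrite Cauchy_Binet; apply: eq_bigr => J _.
  by rewrite aE full_size_minorE -det_map_mx map_mxsub.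
by rewrite YT rmorph1 det1.
Qed.

(** The nonzerodivisor that [minor_multiple_splits] asks for is the minor on the
    lower rows, [\det D]. *)
Lemma comaximal_splits1 :
  GRing.lreg (\det D) -> minor_quotients_comaximal -> splits (col_mx N D) 1.
Proof.
move=> D_lreg [l [lJ suml]]; apply: splits_sum_sqr suml => J.
apply: (@minor_multiple_splits _ _ _ unit_lreg (msubset_nth J) (@rshift n m)).
  by rewrite -dsubmxEsub col_mxKd.
move=> h; have [I [c ->]] := det_rowsub_minor h (col_mx N D).
have [e le] := lJ J I; rewrite !full_size_minorE in le.
by exists (c * e); rewrite mulrCA le mulrA.
Qed.

End FullSizeMinorIdeal.
End Splitting.

(** * Determinants outside a prime ideal *)

Section PrimeIdeal.
Variables (A : comNzRingType) (Z : prime_idealr A).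

Lemma prime_idealr_prod (J : finType) (h : J -> A) :
  (forall j, h j \notin Z) -> \prod_j h j \notin Z.
Proof.
move=> hZ; elim/big_ind: _ => [|x y xZ yZ|//]; first by rewrite idealr1.
by rewrite prime_idealrM negb_or xZ.
Qed.

(** As a function of the multiplier [u] of the [i]-th entry of [r], the
    determinant is affine, equal to [alpha + u * beta].  Given that
    [alpha + beta] is outside [Z], either [alpha] is, and [u = 0] will do, or
    [beta] is and [alpha] is not, and then [u = b] will do. *)
Lemma prime_avoiding_row_update m (M K : 'M[A]_m) (b : A) (r : 'rV[A]_m) i :
    b \notin Z -> \det (M + diag_mx r *m K) \notin Z ->
  exists c, \det (M + diag_mx (\row_j (if j == i then b * c * r 0 j else r 0 j))
                      *m K) \notin Z.
Proof.
move=> bZ rZ; pose R u : 'rV[A]_m := \row_j (if j == i then u * r 0 j else r 0 j).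
pose B : 'M[A]_m :=
  \matrix_(k, j) (if k == i then r 0 k * K k j else M k j + r 0 k * K k j).
have detR u : \det (M + diag_mx (R u) *m K) =
    \det (M + diag_mx (R 0) *m K) + u * \det B.
  rewrite -[X in _ = X + _]mul1r; apply: (@determinant_multilinear _ _ _ _ _ i).
  - apply/rowP => j; rewrite 2!mul_diag_mx !mxE !eqxx mul0r mul0r addr0 mul1r.
    by rewrite -mulrA.
  - apply/matrixP => k j; rewrite 2!mul_diag_mx !mxE.
    by rewrite [_ == i]eq_sym (negbTE (neq_lift _ _)).
  - apply/matrixP => k j; rewrite mul_diag_mx !mxE.
    by rewrite [_ == i]eq_sym (negbTE (neq_lift _ _)).
have R1 : R 1 = r by apply/rowP => j; rewrite mxE mul1r if_same.
rewrite -R1 detR mul1r in rZ.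
have [aZ | aZ] := boolP (\det (M + diag_mx (R 0) *m K) \in Z); last first.
  by exists 0; rewrite mulr0.
exists 1; rewrite mulr1 -/(R b) detR.
have BZ : \det B \notin Z by apply: contra rZ => BZ; rewrite rpredD.
by rewrite rpredDl // prime_idealrM negb_or bZ.
Qed.

(** Start from the row of ones and make its entries divisible by [b] one after
    the other. *)
Lemma prime_avoiding_det m (M K : 'M[A]_m) (b : A) :
    b \notin Z -> \det (M + K) \notin Z ->
  exists s : 'rV[A]_m, \det (M + (b *: diag_mx s) *m K) \notin Z.
Proof.
move=> bZ MKZ.
have step k : (k <= m)%N -> exists r : 'rV[A]_m,
    (forall j : 'I_m, (j < k)%N -> exists c, r 0 j = b * c) /\
    \det (M + diag_mx r *m K) \notin Z.
  elim: k => [_ | k IHk ltkm].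
    by exists (const_mx 1); split=> //; rewrite diag_const_mx mul1mx.
  have [r [rb rZ]] := IHk (ltnW ltkm).
  have [c r'Z] := prime_avoiding_row_update (Ordinal ltkm) bZ rZ.
  eexists; split; last exact: r'Z.
  move=> j; rewrite ltnS leq_eqVlt mxE -val_eqE /=; case: eqP => [_ _|_ /= /rb//].
  by exists (c * r 0 j); rewrite mulrA.
have [r [rb rZ]] := step m (leqnn m).
have [s sE] := choice (fun j : 'I_m => rb j (ltn_ord j)).
exists (\row_j s j); rewrite -linearZ /=.
congr (\det (M + diag_mx _ *m K) \notin Z): rZ.
by apply/rowP => j; rewrite !mxE.
Qed.

End PrimeIdeal.

(** * Closed loops and projectors *)

Section FeedbackAlgebra.
Variables (F : comUnitRingType) (n m : nat).
Implicit Types (P : 'M[F]_(n, m)) (C : 'M[F]_(m, n)).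

(** The inverse of [1 + C P] is [1 - C (1 + P C)^-1 P]. *)
Lemma unitmx_1addmulC P C :
  1%:M + P *m C \in unitmx -> 1%:M + C *m P \in unitmx.
Proof.
move=> uPC; set V := 1%:M + P *m C in uPC *.
have CV : C *m V = (1%:M + C *m P) *m C.
  by rewrite mulmxDl mulmxDr mulmx1 mul1mx mulmxA.
suff /mulmx1_unit[] : (1%:M + C *m P) *m (1%:M - C *m invmx V *m P) = 1%:M by [].
rewrite mulmxBr mulmx1 !mulmxA -CV mulmxK //.
by rewrite addrK.
Qed.

Lemma mulmx_inv_1addmul P C : 1%:M + P *m C \in unitmx ->
  C *m invmx (1%:M + P *m C) = invmx (1%:M + C *m P) *m C.
Proof.
move=> uPC; have uCP := unitmx_1addmulC uPC.
apply: (can_inj (mulKmx uCP)); rewrite mulKVmx // mulmxA.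
have -> : (1%:M + C *m P) *m C = C *m (1%:M + P *m C).
  by rewrite mulmxDl mulmxDr mulmx1 mul1mx mulmxA.
by rewrite mulmxK.
Qed.

(** The left-hand side is the projector onto the graph of [P] attached to the
    controller [C]; its blocks are those of the closed loop, except that the
    upper left one is complemented and the upper right one has opposite sign. *)
Lemma closed_loop_projector P C : 1%:M + P *m C \in unitmx ->
  col_mx P 1%:M *m (invmx (1%:M + C *m P) *m row_mx C 1%:M) =
  block_mx (1%:M - invmx (1%:M + P *m C)) (P *m invmx (1%:M + C *m P))
           (C *m invmx (1%:M + P *m C)) (invmx (1%:M + C *m P)).
Proof.
move=> uPC; rewrite mul_mx_row mulmx1 mul_col_row !mul1mx -mulmx_inv_1addmul //.
congr block_mx; rewrite mulmxA -[X in X - _](mulmxV uPC) mulmxDl mul1mx.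
by rewrite [RHS]addrC addKr.
Qed.

End FeedbackAlgebra.

Section Plant.
Variables (A : comNzRingType) (F : comUnitRingType) (iota : {rmorphism A -> F}).
Hypothesis hF : is_total_fraction_ring iota.
Variables (n m : nat) (P : 'M[F]_(n, m)).

Lemma total_fraction_unit (x : F) : GRing.lreg x -> x \is a GRing.unit.
Proof.
case: hF => iota_inj unit_lreg frac.
have [a [b [b_lreg ->]]] := frac x => x_lreg.
have b_unit := unit_lreg b b_lreg.
rewrite unitrM unitrV b_unit andbT; apply: unit_lreg => u v auv.
apply: iota_inj; apply: x_lreg.
by rewrite ![_ / _ * _]mulrAC -!rmorphM auv.
Qed.

Lemma integral_closed_loop (C : 'M[F]_(m, n)) : 1%:M + P *m C \in unitmx ->
  integral_mx iota (closed_loop P C) <->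
  integral_mx iota
    (col_mx P 1%:M *m (invmx (1%:M + C *m P) *m row_mx C 1%:M)).
Proof.
move=> uPC; rewrite closed_loop_projector // !integral_block_mx.
split=> -[H1 H2 H3 H4]; split=> //.
- by apply: integral_mxD; [apply: integral_mx1 | apply: integral_mxN].
- by rewrite -[X in integral_mx _ X]opprK; apply: integral_mxN.
- rewrite -[X in integral_mx _ X](subKr 1%:M); apply: integral_mxD.
    exact: integral_mx1.
  exact: integral_mxN.
- exact: integral_mxN.
Qed.

Lemma stabilizable_projector : stabilizable iota P ->
  exists X, X *m col_mx P 1%:M = 1%:M /\ integral_mx iota (col_mx P 1%:M *m X).
Proof.
move=> [C [/total_fraction_unit uPC]].
rewrite -/(_ \in unitmx) in uPC.
move=> /(integral_closed_loop uPC) PX.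
exists (invmx (1%:M + C *m P) *m row_mx C 1%:M); split=> //.
rewrite -mulmxA mul_row_col mul1mx [C *m P + _]addrC mulVmx //.
exact: unitmx_1addmulC.
Qed.

(** From [X1 P + X2 = 1], the controller [C = X2^-1 X1] satisfies
    [1 + C P = X2^-1], so that [X] is the factor [(1 + C P)^-1 [C, 1]] of the
    projector attached to [C]. *)
Lemma projector_stabilizable (X : 'M[F]_(m, n + m)) :
    X *m col_mx P 1%:M = 1%:M -> integral_mx iota (col_mx P 1%:M *m X) ->
    rsubmx X \in unitmx ->
  stabilizable iota P.
Proof.
move=> XP PX uX.
pose C := invmx (rsubmx X) *m lsubmx X.
have CP : 1%:M + C *m P = invmx (rsubmx X).
  apply: (can_inj (mulKmx uX)); rewrite mulmxV // mulmxDr mulmx1 mulmxA mulKVmx //.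
  by rewrite addrC -[rsubmx X]mulmx1 -mul_row_col hsubmxK.
have uPC : 1%:M + P *m C \in unitmx.
  by apply: unitmx_1addmulC; rewrite CP unitmx_inv.
exists C; split; first exact: mulrI.
apply/(integral_closed_loop uPC); rewrite CP invmxK mul_mx_row mulmx1 mulKVmx //.
by rewrite hsubmxK.
Qed.

(** * Causal plants *)

Section Causal.
Variables (Z : prime_idealr A) (hZ : forall a : A, ~ GRing.lreg a -> a \in Z).

Lemma notin_prime_unit b : b \notin Z -> iota b \is a GRing.unit.
Proof.
case: hF => _ unit_lreg _ bZ; apply: unit_lreg.
by apply: contrapT => /hZ; apply/negP.
Qed.

Lemma causal_common_denominator : causal_mx iota Z P ->
  exists2 b, b \notin Z & integral_mx iota (iota b *: P).
Proof.
move=> Pc; have [a] := choice (fun u : 'I_n * 'I_m => Pc u.1 u.2).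
move=> /choice[b abE]; exists (\prod_u b u).
  by apply: prime_idealr_prod => u; have [] := abE u.
move=> i j; have [bZ Pij] := abE (i, j).
exists (\prod_(u | u != (i, j)) b u * a (i, j)).
rewrite mxE (bigD1 (i, j)) //= Pij !rmorphM /= [iota (b _) * _]mulrC -mulrA.
by rewrite [iota (b _) * _]mulrCA divrr ?mulr1 // notin_prime_unit.
Qed.

(** Any [W] with [G *m W] integral gives another solution
    [X + W *m (1 - G *m X)]; the choice [W = [0, b R]], with [b] a common
    denominator of [P], makes its right block invertible for some [R]. *)
Lemma causal_projector_stabilizable (X : 'M[F]_(m, n + m)) :
    causal_mx iota Z P ->
    X *m col_mx P 1%:M = 1%:M -> integral_mx iota (col_mx P 1%:M *m X) ->
  stabilizable iota P.
Proof.
move=> /causal_common_denominator[b bZ bP] XP PX.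
set G := col_mx P 1%:M in XP PX *.
have [X2 X2E] : exists X2, rsubmx X = map_mx iota X2.
  apply/integral_mxP; move: PX; rewrite -{1}[X]hsubmxK /G mul_col_row.
  by move=> /integral_block_mx[_ _ _]; rewrite mul1mx.
have [s sZ] : exists s, \det (X2 + (b *: diag_mx s) *m (1%:M - X2)) \notin Z.
  by apply: prime_avoiding_det; rewrite // addrC subrK det1 idealr1.
pose R := map_mx iota (b *: diag_mx s).
pose W : 'M[F]_(m, n + m) := row_mx 0 R.
have GW : integral_mx iota (G *m W).
  rewrite mul_col_row !mulmx0 mul1mx integral_block_mx.
  split; try by rewrite -(map_mx0 iota); apply: integral_map_mx.
    rewrite /R map_mxZ -scalemxAr scalemxAl.
    by apply: integral_mxM bP _; apply: integral_map_mx.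
  exact: integral_map_mx.
apply: (@projector_stabilizable (X + W *m (1%:M - G *m X))).
- by rewrite mulmxDl XP -mulmxA mulmxBl mul1mx -mulmxA XP mulmx1 subrr mulmx0 addr0.
- rewrite mulmxDr mulmxA; apply: integral_mxD => //; apply: integral_mxM => //.
  by apply: integral_mxD; [apply: integral_mx1 | apply: integral_mxN].
suff -> : rsubmx (X + W *m (1%:M - G *m X)) =
    map_mx iota (X2 + (b *: diag_mx s) *m (1%:M - X2)).
  by rewrite unitmxE det_map_mx notin_prime_unit.
rewrite linearD /= X2E map_mxD map_mxM map_mxB map_mx1 -/R; congr (_ + _).
rewrite -X2E -{1}[X]hsubmxK mul_col_row (scalar_mx_block n m) opp_block_mx.
by rewrite add_block_mx /W mul_row_block row_mxKr mul0mx add0r mul1mx.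
Qed.

End Causal.
End Plant.

(** The two kinds of splitting correspond by [X = D Y], since [T = G D]. *)
Lemma splits1_projector (A : comNzRingType) (F : comUnitRingType)
    (iota : {rmorphism A -> F}) (n m : nat) (N : 'M[A]_(n, m)) (D : 'M[A]_m) :
    map_mx iota D \in unitmx ->
  splits iota (col_mx N D) 1 <->
  exists X, X *m col_mx (map_mx iota N *m invmx (map_mx iota D)) 1%:M = 1%:M /\
    integral_mx iota (col_mx (map_mx iota N *m invmx (map_mx iota D)) 1%:M *m X).
Proof.
move=> uD; set G := col_mx (_ *m _) _.
have TE : map_mx iota (col_mx N D) = G *m map_mx iota D.
  by rewrite map_col_mx /G mul_col_mx mulmxKV // mul1mx.
rewrite /splits TE; split=> [[Y [YT TY]] | [X [XG GX]]].
  exists (map_mx iota D *m Y); rewrite mulmxA; split=> //.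
  apply: (can_inj (mulmxK uD)); rewrite mul1mx -!mulmxA YT.
  by rewrite rmorph1 mulmx1.
exists (invmx (map_mx iota D) *m X); split.
  by rewrite mulmxA -[_ *m X *m G]mulmxA XG mulmx1 mulVmx // rmorph1.
by rewrite -mulmxA mulKVmx.
Qed.

End FullSizeMinorCriterion.

Theorem theorem6p1
  (A : comNzRingType) (F : comUnitRingType) (iota : {rmorphism A -> F})
  (hF : is_total_fraction_ring iota)
  (Z : prime_idealr A)
  (hZ : forall a : A, ~ GRing.lreg a -> a \in Z)
  (n m : nat) (hn : (0 < n)%N) (hm : (0 < m)%N)
  (P : 'M[F]_(n, m)) (hP : causal_mx iota Z P)
  (N : 'M[A]_(n, m)) (D : 'M[A]_m)
  (hND : fractional_representation iota P N D) :
  stabilizable iota P <->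
  sum_ideal (fun I : msubset n m =>
    quotient_ideal (principal_ideal (full_size_minor N D I))
                   (full_size_minor_ideal N D)) = setT.
Proof.
have [iota_inj unit_lreg _] := hF; have [D_lreg PE] := hND.
have uD : map_mx iota D \in unitmx by rewrite unitmxE det_map_mx unit_lreg.
have projP := splits1_projector N uD; rewrite -PE in projP.
rewrite minor_quotients_comaximalP; split.
  by move=> /(stabilizable_projector hF)/projP; apply: splits1_comaximal.
move=> /(comaximal_splits1 unit_lreg D_lreg)/projP[X [XG GX]].
exact: causal_projector_stabilizable hP XG GX.
Qed.
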